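(* For all integers $r\ge 3$ and $d\ge 1$, $$\chi_a^r(d)\le 2^{\frac{9r}{2}-2}\,3^3\,(rd)^{\frac{6}{3r-4}} .$$
   Context: All hypergraphs are finite. A hypergraph is $r$-uniform if every hyperedge has exactly $r$ vertices; $K_n^r$ is the complete $r$-uniform hypergraph on $n$ vertices; $\Delta(H)$ is the maximum vertex degree of $H$ (the degree of a vertex is the number of hyperedges containing it). Subhypergraphs are understood as formed by a set of hyperedges together with the vertices in their union. A hyperedge is monochromatic under a vertex coloring if all its vertices have the same color; a subhypergraph is bicolored if its vertices receive exactly two colors. A cycle of length $m$ is a subhypergraph with (distinct) hyperedges $E_0,\dots,E_{m-1}$ such that $E_i\cap E_{i+1}\ne\emptyset$ and $E_{i-1}\cap E_i\cap E_{i+1}=\emptyset$ for each $i$, indices modulo $m$. An acyclic coloring of a hypergraph $H$ is a vertex coloring of $H$ with no monochromatic hyperedge and no bicolored cycle of length at least three. The acyclic chromatic number $\chi_a(H)$ is the minimum number of colors in an acyclic coloring of $H$, and $$\chi_a^r(d)=\max\{\chi_a(H): H\subset K_n^r\text{ for some } n,\ \Delta(H)=d\},$$ i.e. the maximum is over all $r$-uniform hypergraphs $H$ with maximum degree $d$. *)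

(* Defs.v *)
From mathcomp Require Import all_boot boolp.

Set Implicit Arguments.
Unset Strict Implicit.
Unset Printing Implicit Defensive.

(* A hypergraph is its set [H : {set {set T}}] of hyperedges, over an ambient
   finite vertex type [T].  Vertices of [T] outside [cover H] are allowed; they
   lie on no hyperedge, so their colors are unconstrained. *)

Definition uniform (r : nat) (T : finType) (H : {set {set T}}) : Prop :=
  forall A, A \in H -> #|A| = r.

Definition degree (T : finType) (H : {set {set T}}) (v : T) : nat :=
  #|[set A in H | v \in A]|.

Definition max_degree (T : finType) (H : {set {set T}}) : nat :=
  \max_(v : T) degree H v.

Definition monochromatic (T C : finType) (c : T -> C) (A : {set T}) : Prop :=
  {in A &, forall x y, c x = c y}.

Definition bicolored (T C : finType) (c : T -> C) (F : {set {set T}}) : Prop :=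
  #|c @: cover F| = 2.

(* [ordS] and [ord_pred] are the successor and predecessor modulo [m]. *)
Definition is_cycle (m : nat) (T : finType) (F : {set {set T}}) : Prop :=
  exists E : 'I_m -> {set T},
    [/\ injective E, F = [set E i | i : 'I_m],
        forall i, E i :&: E (ordS i) <> set0 &
        forall i, E (ord_pred i) :&: E i :&: E (ordS i) = set0].

Definition acyclic_coloring (T C : finType) (H : {set {set T}}) (c : T -> C) :
    Prop :=
  (forall A, A \in H -> ~ monochromatic c A) /\
  (forall (m : nat) (F : {set {set T}}),
     3 <= m -> F \subset H -> is_cycle m F -> ~ bicolored c F).

Definition acyclic_colorable (T : finType) (H : {set {set T}}) (k : nat) :
    Prop :=
  exists c : T -> 'I_k, acyclic_coloring H c.

(* The search is over [k <= #|T|], with value [#|T|] if it fails.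
   [acyclic_chromatic_numberP] shows that it does not fail for the hypergraphs
   of interest: the value is then the true minimum over all [k]. *)
Definition acyclic_chromatic_number (T : finType) (H : {set {set T}}) : nat :=
  [arg min_(k < (ord_max : 'I_#|T|.+1) | `[< acyclic_colorable H k >]) k].

Lemma acyclic_colorable_card (r : nat) (T : finType) (H : {set {set T}}) :
  3 <= r -> uniform r H -> acyclic_colorable H #|T|.
Proof.
move=> r3 uH; exists enum_rank; split=> [A AH mono|m F m3 /subsetP FH].
  have /cards1P[x Ax] : #|A| == 1.
    rewrite eqn_leq; apply/andP; split; last by rewrite (uH _ AH) (leq_trans _ r3).
    by apply/card_le1P => x xA y; rewrite inE; apply/idP/eqP => [yA|->//];
       apply: enum_rank_inj; apply: mono.
  by move: (uH _ AH) r3; rewrite Ax cards1 => <-.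
case=> E [_ FE _ _]; rewrite /bicolored card_imset; last exact: enum_rank_inj.
have E0F : E (Ordinal (ltn_trans (isT : 0 < 2) m3)) \in F.
  by rewrite FE; apply/imsetP; eexists.
move=> c2; have := subset_leq_card (bigcup_sup _ E0F : _ \subset cover F).
by rewrite c2 (uH _ (FH _ E0F)) leqNgt r3.
Qed.

Lemma acyclic_chromatic_numberP (r : nat) (T : finType) (H : {set {set T}}) :
  3 <= r -> uniform r H ->
  acyclic_colorable H (acyclic_chromatic_number H) /\
  (forall k, acyclic_colorable H k -> acyclic_chromatic_number H <= k).
Proof.
move=> r3 uH; rewrite /acyclic_chromatic_number; case: arg_minnP => /=.
  exact/asboolP/(acyclic_colorable_card r3 uH).
move=> i /asboolP iP imin; split=> // k kP.
have [kT|Tk] := leqP k #|T|.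
  by apply: (imin (Ordinal (kT : k < #|T|.+1))); apply/asboolP.
by apply: leq_trans (ltnW Tk); rewrite -ltnS.
Qed.

(* [m] is the maximum of the acyclic chromatic numbers of the [r]-uniform
   hypergraphs of maximum degree [d]; such an [m] is unique. *)
Definition is_max_acyclic_chromatic_number (r d m : nat) : Prop :=
  (exists (n : nat) (H : {set {set 'I_n}}),
     [/\ uniform r H, max_degree H = d & acyclic_chromatic_number H = m]) /\
  (forall (n : nat) (H : {set {set 'I_n}}),
     uniform r H -> max_degree H = d -> acyclic_chromatic_number H <= m).

(* Main.v *)
Require Import Defs.
From mathcomp Require Import all_boot all_order all_algebra.
From mathcomp Require Import reals exp.
From mathcomp Require Import boolp zify ring lra.
Import Order.TTheory GRing.Theory Num.Theory.

Set Implicit Arguments.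
Unset Strict Implicit.
Unset Printing Implicit Defensive.

(** The proof counts colorings.

    A bicolored cycle of length at least three contains three consecutive
    hyperedges [L], [M], [R]; both [L] and [R] meet [M], no vertex is in all
    three, and their union sees at most two colors.  So it is enough to color
    the vertices such that no hyperedge sees only one color and no such triple,
    a cherry with middle [M], sees at most two ([acyclic_coloring_cherries]).
    A vertex of a cherry is in at most two of its three hyperedges, hence the
    union has at least [3r/2] vertices ([card_cherry_union]), and at most
    [3 r^2 d^3] cherries go through a given vertex ([card_cherries]).  With [k]
    colors, a uniformly random coloring spoils a given cherry with probability
    of order [k^(2 - 3r/2)] up to a factor exponential in [r], and
    [k^((3r-4)/2) >= C^r (rd)^3] is where the exponent [6/(3r-4)] comes from.

    Such local conditions can be met simultaneously by an argument of Rosenfeld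
    that replaces the Lovasz local lemma ([few_colors_local_lemma]).  Let
    [N(S)] be the number of colorings of all vertices that satisfy every
    condition supported in [S].  Adding a vertex [v] to [S] at most halves [N]:
    a coloring counted in [N(S)] and lost in [N(S + v)] spoils a condition with
    support [U] containing [v]; what happens on [U] is independent of the
    conditions supported in [S - U], and by induction [N(S - U)] is at most
    [2^(|U|-1) N(S)], so the lost colorings are at most [N(S)/2] as soon as the
    sum over the supports [U] through [v] of [2^|U|] times the probability of
    spoiling [U] is at most [1].  As [N] of the empty set is positive, so is
    [N] of the whole vertex set.

    Any number [k] of colors with [k >= 16 (rd)^(6/(3r-4))] satisfies this
    inequality ([acyclic_colorable_powR]), and the constant of the theorem
    leaves ample room for rounding. *)

(** * Colorings with few colors on a set *)

Lemma card_bigcup_leq (T : finType) (J : Type) (s : seq J) (P : pred J)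
    (F : J -> {set T}) :
  #|\bigcup_(i <- s | P i) F i| <= \sum_(i <- s | P i) #|F i|.
Proof.
elim/big_rec2: _ => [|i m A _ Am]; first by rewrite cards0.
by apply: leq_trans (leq_card_setU _ _) _; rewrite leq_add2l.
Qed.

(** Naming the allowed colors by a tuple, rather than bounding the size of the
    image of [U], gives a union over exactly [#|C| ^ j] cases. *)
Definition few_colors (T C : finType) (j : nat) (U : {set T})
    (c : {ffun T -> C}) : bool :=
  [exists s : j.-tuple C, [forall x in U, c x \in s]].

Lemma few_colors_eq_in (T C : finType) j (U : {set T}) (c c' : {ffun T -> C}) :
  {in U, c =1 c'} -> few_colors j U c = few_colors j U c'.
Proof.
move=> cc'; apply: eq_existsb => s; apply: eq_forallb => x.
by case xU: (x \in U) => //=; rewrite cc'.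
Qed.

(** Choose the [j] colors, then a color among these for each vertex of [U] and
    an arbitrary color for each other vertex. *)
Lemma card_few_colors (T C : finType) j (U : {set T}) :
  #|[set c : {ffun T -> C} | few_colors j U c]|
    <= #|C| ^ j * (j ^ #|U| * #|C| ^ #|~: U|).
Proof.
pose F (s : j.-tuple C) (x : T) : pred C :=
  fun a => (x \in U) ==> (a \in s).
pose G s := [set c : {ffun T -> C} | c \in family (F s)].
have sub : [set c : {ffun T -> C} | few_colors j U c] \subset
    \bigcup_(s : j.-tuple C) G s.
  apply/subsetP => c; rewrite inE => /existsP[s cs].
  by apply/bigcupP; exists s => //; rewrite inE; apply/familyP => x;
     exact: (forallP cs x).
apply: leq_trans (subset_leq_card sub) _.
apply: leq_trans (card_bigcup_leq _ _ _) _.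
rewrite -card_tuple -sum_nat_const; apply: leq_sum => s _.
rewrite cardsE card_family foldrE big_map big_enum /=.
rewrite (bigID (mem U)) /= leq_mul //.
  rewrite -prod_nat_const; apply: leq_prod => x xU.
  rewrite -[X in _ <= X](size_tuple s).
  by rewrite (eq_card (B := mem s)) ?card_size // => a; rewrite /F unfold_in xU.
rewrite (eq_bigl (mem (~: U))) => [|x]; last by rewrite !inE.
by rewrite -prod_nat_const; apply: leq_prod => x _; apply: max_card.
Qed.

(** Independence of two events that depend on disjoint sets of coordinates,
    here without probabilities: exchanging the values on [U] of the two members
    of a pair of colorings is an involution, and it turns a pair in [A * B] into
    one whose first member is in both [A] and [B] and whose second is
    arbitrary. *)
Lemma card_setI_independent (T C : finType) (U : {set T})
    (A B : {set {ffun T -> C}}) :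
  (forall c c' : {ffun T -> C}, {in ~: U, c =1 c'} -> (c \in A) = (c' \in A)) ->
  (forall c c' : {ffun T -> C}, {in U, c =1 c'} -> (c \in B) = (c' \in B)) ->
  #|A :&: B| * #|C| ^ #|T| = #|A| * #|B|.
Proof.
move=> locA locB.
pose mix (a b : {ffun T -> C}) := [ffun x => if x \in U then a x else b x].
pose swap (p : {ffun T -> C} * {ffun T -> C}) := (mix p.2 p.1, mix p.1 p.2).
have swapK : involutive swap.
  by case=> a b; rewrite /swap /=; congr (_, _); apply/ffunP => x;
     rewrite !ffunE /=; case: (x \in U).
have -> : #|C| ^ #|T| = #|[set: {ffun T -> C}]| by rewrite cardsT card_ffun.
rewrite -!cardsX -(card_preimset (setX (A :&: B) _) (inv_inj swapK)).
congr #|pred_of_set _|; apply/setP => -[a b]; rewrite !inE /= andbT; congr (_ && _).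
  by apply: locA => x; rewrite inE ffunE => /negbTE ->.
by apply: locB => x; rewrite ffunE => ->.
Qed.

(** * The counting local lemma *)

(** A pair [(j, U)] in [Phi] stands for the condition that [U] sees more than
    [j] colors.  The colorings are defined on all of [T], not just on [S], so
    that the sets for different [S] can be compared. *)
Definition proper_within (T C : finType) (Phi : seq (nat * {set T}))
    (S : {set T}) : {set {ffun T -> C}} :=
  [set c : {ffun T -> C} | all (fun f : nat * {set T} =>
    (f.2 \subset S) ==> ~~ few_colors f.1 f.2 c) Phi].

Lemma proper_within_eq_in (T C : finType) (Phi : seq (nat * {set T}))
    (S : {set T}) (c c' : {ffun T -> C}) :
  {in S, c =1 c'} ->
  (c \in proper_within C Phi S) = (c' \in proper_within C Phi S).
Proof.
move=> cc'; rewrite !inE; apply: eq_all => f.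
case: (boolP (f.2 \subset S)) => //= fS; congr (~~ _).
by apply: few_colors_eq_in => x xf; apply/cc'/(subsetP fS).
Qed.

Lemma proper_within_anti (T C : finType) (Phi : seq (nat * {set T}))
    (S S' : {set T}) :
  S \subset S' -> proper_within C Phi S' \subset proper_within C Phi S.
Proof.
move=> SS'; apply/subsetP => c; rewrite !inE => /allP cP.
apply/allP => f /cP /implyP fP; apply/implyP => fS.
exact/fP/(subset_trans fS).
Qed.

Local Open Scope ring_scope.

(** The factor [2 ^ #|U|] times the upper bound [k^j (j/k)^|U|] for the
    probability that a random coloring with [k] colors has at most [j] colors on
    [U]; the [2] is the factor by which one more vertex can divide the number of
    colorings. *)
Definition weight (R : realFieldType) (k : nat) (T : finType)
    (f : nat * {set T}) : R :=
  k%:R ^+ f.1 * ((2 * f.1)%:R / k%:R) ^+ #|f.2|.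

(** Put the vertices of [W] back one at a time: each costs a factor [2]. *)
Lemma card_proper_within_setD (R : realFieldType) (T C : finType)
    (Phi : seq (nat * {set T})) (S : {set T}) :
  (forall (S' : {set T}) v, (#|S'| < #|S|)%N -> v \notin S' ->
     #|proper_within C Phi S'|%:R <= 2 * #|proper_within C Phi (v |: S')|%:R :> R) ->
  forall W : {set T}, W \subset S ->
  #|proper_within C Phi (S :\: W)|%:R <= 2 ^+ #|W| * #|proper_within C Phi S|%:R :> R.
Proof.
move=> IH W; move: {2}#|W| (erefl #|W|) => n; elim: n W => [|n IHn] W Wn WS; rewrite Wn.
  by rewrite expr0 mul1r (cards0_eq Wn) setD0.
have [w wW] : exists w, w \in W by apply/set0Pn; rewrite -card_gt0 Wn.
have cW : #|W :\ w| = n by move: Wn; rewrite (cardsD1 w) wW => -[].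
have wS : w \in S by apply: (subsetP WS).
have := IHn _ cW (subset_trans (subsetDl _ _) WS); rewrite cW.
rewrite -(ler_pM2l (ltr0n R 2)) mulrA -exprS; apply: le_trans.
have -> : S :\: (W :\ w) = w |: (S :\: W).
  apply/setP => x; rewrite !inE negb_and negbK.
  by case: eqP => [->|] /=; rewrite ?wS.
apply: IH; last by rewrite inE wW.
apply: proper_card; rewrite properE subsetDl /=.
by apply/subsetPn; exists w => //; rewrite inE wW.
Qed.

(** Forget the conditions that touch [f.2]: the others do not depend on the
    colors there. *)
Lemma card_proper_within_few_colors (R : realFieldType) (T C : finType)
    (Phi : seq (nat * {set T})) (S : {set T}) (f : nat * {set T}) :
  (0 < #|C|)%N ->
  #|proper_within C Phi S :&: [set c | few_colors f.1 f.2 c]|%:R <=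
  #|proper_within C Phi (S :\: f.2)|%:R *
    (#|C|%:R ^+ f.1 * (f.1%:R / #|C|%:R) ^+ #|f.2|) :> R.
Proof.
move=> C_gt0; set k := #|C|; set B := [set c | _]; set U := f.2.
have k0 : 0 < k%:R :> R by rewrite ltr0n.
have kT0 : 0 < (k ^ #|T|)%N%:R :> R by rewrite natrX exprn_gt0.
apply: (@le_trans _ _ #|proper_within C Phi (S :\: U) :&: B|%:R).
  by rewrite ler_nat subset_leq_card // setSI // proper_within_anti // subsetDl.
rewrite -(ler_pM2r kT0) -natrM.
rewrite (@card_setI_independent _ _ U); first last.
- by move=> c c' cc'; rewrite !inE (few_colors_eq_in _ cc').
- move=> c c' cc'; apply: proper_within_eq_in => x; rewrite inE => /andP[xU _].
  by apply: cc'; rewrite inE.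
rewrite natrM -mulrA ler_wpM2l //.
have := @card_few_colors T C f.1 U; rewrite -/k -(ler_nat R) => /le_trans; apply.
rewrite -[in X in _ <= _ * X](cardsC U).
rewrite !natrM !natrX exprD expr_div_n -!mulrA ler_wpM2l ?exprn_ge0 //.
rewrite ler_wpM2l ?exprn_ge0 // mulKf // expf_neq0 // gt_eqF //.
Qed.

Lemma weight_ge0 (R : realFieldType) k (T : finType) (f : nat * {set T}) :
  0 <= weight R k f.
Proof. by rewrite mulr_ge0 ?exprn_ge0 ?divr_ge0 ?ler0n. Qed.

(** Adding a vertex loses at most half of the colorings.  A lost coloring spoils
    some [f] with [v] in [f.2]; the vertex [v] is not yet in [S], so deleting
    [f.2] from [S] removes at most [#|f.2| - 1] vertices, and this exponent
    provides the spare factor [1/2]. *)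
Lemma proper_within_setU1 (R : realFieldType) (T C : finType)
    (Phi : seq (nat * {set T})) :
  (0 < #|C|)%N ->
  (forall v, \sum_(f <- Phi | v \in f.2) weight R #|C| f <= 1) ->
  forall (S : {set T}) v, v \notin S ->
  #|proper_within C Phi S|%:R <= 2 * #|proper_within C Phi (v |: S)|%:R :> R.
Proof.
move=> C_gt0 wPhi S v; move: {2}#|S|.+1 (ltnSn #|S|) => n.
elim: n S v => // n IHn S v Sn vS.
set N := fun S : {set T} => (#|proper_within C Phi S|%:R : R).
rewrite -/(N S) -/(N (v |: S)).
pose B f := proper_within C Phi S :&: [set c : {ffun T -> C} | few_colors f.1 f.2 c].
pose critical (f : nat * {set T}) := (v \in f.2) && (f.2 \subset v |: S).
have critical_bound f : critical f -> #|B f|%:R <= N S / 2 * weight R #|C| f.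
  case/andP=> vf fS.
  apply: le_trans (card_proper_within_few_colors _ _ _ _ C_gt0) _.
  have -> : S :\: f.2 = S :\: (f.2 :\ v).
    by apply/setP => x; rewrite !inE; case: eqP => [->|//]; rewrite vf (negPf vS).
  have fvS : f.2 :\ v \subset S.
    apply/subsetP => x; rewrite !inE => /andP[xv /(subsetP fS)].
    by rewrite !inE (negPf xv).
  have := @card_proper_within_setD R T C Phi S _ _ fvS.
  rewrite -/(N (S :\: _)) -/(N S) => step.
  have {}step := step (fun S' w S'S => IHn S' w (leq_trans S'S Sn)).
  have -> : weight R #|C| f = 2 * 2 ^+ #|f.2 :\ v| *
      (#|C|%:R ^+ f.1 * (f.1%:R / #|C|%:R) ^+ #|f.2|).
    have cardf : #|f.2| = #|f.2 :\ v|.+1 by rewrite (cardsD1 v f.2) vf.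
    rewrite -exprS -cardf /weight.
    by rewrite natrM -mulrA exprMn mulrCA.
  apply: le_trans (ler_wpM2r _ step) _.
    by rewrite mulr_ge0 ?exprn_ge0 ?divr_ge0.
  by rewrite le_eqVlt; apply/orP; left; apply/eqP; field.
have cover_bad : proper_within C Phi S \subset
    proper_within C Phi (v |: S) :|: \bigcup_(f <- Phi | critical f) B f.
  apply/subsetP => c cS; rewrite inE -implyNb; apply/implyP.
  rewrite [in X in X -> _]inE => /allPn[f fPhi]; rewrite negb_imply negbK => /andP[fS fc].
  have vf : v \in f.2.
    apply: contraLR fc => vf; move: cS; rewrite inE => /allP/(_ f fPhi)/implyP; apply.
    apply/subsetP => x xf; have := subsetP fS x xf; rewrite !inE.
    by case: eqP => // xv; move: vf; rewrite -xv xf.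
  by rewrite (big_rem f) //= /critical vf fS /= inE in_setI cS inE fc.
have : N S <= N (v |: S) + \sum_(f <- Phi | critical f) #|B f|%:R.
  rewrite -natr_sum -natrD ler_nat.
  apply: leq_trans (subset_leq_card cover_bad) _.
  by apply: leq_trans (leq_card_setU _ _) _; rewrite leq_add2l card_bigcup_leq.
have : \sum_(f <- Phi | critical f) #|B f|%:R <= N S / 2.
  apply: (@le_trans _ _ (\sum_(f <- Phi | v \in f.2) N S / 2 * weight R #|C| f)).
    rewrite [leRHS](bigID (fun f : nat * {set T} => f.2 \subset v |: S)) /=.
    rewrite -[leLHS]addr0 lerD ?ler_sum // sumr_ge0 // => f _.
    by rewrite mulr_ge0 ?weight_ge0 // divr_ge0 ?ler0n.
  by rewrite -mulr_sumr ler_piMr // divr_ge0.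
move: (N S) (N _) (\sum_(_ <- _ | _) _) => x y z; lra.
Qed.

(** A condition with empty support would not be seen by the sums, which run over
    the conditions through a vertex; hence the second hypothesis. *)
Theorem few_colors_local_lemma (R : realFieldType) (T C : finType)
    (Phi : seq (nat * {set T})) :
  (0 < #|C|)%N -> {in Phi, forall f, f.2 != set0} ->
  (forall v, \sum_(f <- Phi | v \in f.2) weight R #|C| f <= 1) ->
  exists c : {ffun T -> C}, {in Phi, forall f, ~~ few_colors f.1 f.2 c}.
Proof.
move=> C_gt0 Phi0 wPhi.
suff /card_gt0P[c] : (0 < #|proper_within C Phi setT|)%N.
  by rewrite inE => /allP cP; exists c => f /cP; rewrite subsetT.
have := @card_proper_within_setD R T C Phi setT
  (fun S v _ => proper_within_setU1 C_gt0 wPhi (v := v)) _ (subsetT setT).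
rewrite setDv; have -> : proper_within C Phi set0 = setT.
  apply/setP => c; rewrite !inE; apply/allP => f /Phi0 f0.
  by rewrite subset0 (negPf f0).
rewrite cardsT card_ffun; apply: contraTltn; rewrite leqn0 => /eqP ->.
by rewrite mulr0 -ltNge ltr0n expn_gt0 C_gt0.
Qed.

(** * Cherries in a hypergraph *)

Local Open Scope nat_scope.

Definition edge_nbrs (T : finType) (H : {set {set T}}) (A : {set T}) :
    {set {set T}} :=
  [set B in H | A :&: B != set0].

(** A cherry is encoded as [(M, L, R)], with its middle hyperedge first: [L] and
    [R] are then both chosen in terms of the first component. *)
Definition cherries (T : finType) (H : {set {set T}}) :
    {set {set T} * {set T} * {set T}} :=
  [set p | [&& p.1.1 \in H, p.1.2 \in edge_nbrs H p.1.1,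
    p.2 \in edge_nbrs H p.1.1 & p.1.1 :&: p.1.2 :&: p.2 == set0]].

Definition cherry_union (T : finType) (p : {set T} * {set T} * {set T}) :
    {set T} :=
  p.1.1 :|: p.1.2 :|: p.2.

Lemma card_dependent_pairs (A B : finType) (D : {set A}) (F : A -> {set B}) m :
  {in D, forall a, #|F a| <= m} ->
  #|[set p | p.1 \in D & p.2 \in F p.1]| <= #|D| * m.
Proof.
move=> Fm; have sub : [set p | p.1 \in D & p.2 \in F p.1] \subset
    \bigcup_(a in D) [set (a, b) | b in F a].
  apply/subsetP => -[a b]; rewrite inE => /andP[/= aD bF].
  by apply/bigcupP; exists a => //; apply: imset_f.
apply: leq_trans (subset_leq_card sub) _.
apply: leq_trans (card_bigcup_leq _ _ _) _.
rewrite -sum_nat_const; apply: leq_sum => a aD.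
exact: leq_trans (leq_imset_card _ _) (Fm a aD).
Qed.

Lemma card_edge_nbrs (T : finType) (H : {set {set T}}) d (A : {set T}) :
  (forall v, degree H v <= d) -> #|edge_nbrs H A| <= #|A| * d.
Proof.
move=> Hd; have sub : edge_nbrs H A \subset
    \bigcup_(x in A) [set B in H | x \in B].
  apply/subsetP => B; rewrite inE => /andP[BH /set0Pn[x]].
  by rewrite inE => /andP[xA xB]; apply/bigcupP; exists x; rewrite // inE BH.
apply: leq_trans (subset_leq_card sub) _.
apply: leq_trans (card_bigcup_leq _ _ _) _.
by rewrite -sum_nat_const; apply: leq_sum => x _; apply: Hd.
Qed.

(** The vertex [v] lies in one of the three hyperedges.  Choose that one among
    the at most [d] hyperedges through [v], then reach the other two by two
    steps to a neighboring hyperedge, each with at most [r d] choices. *)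
Lemma card_cherries (T : finType) (H : {set {set T}}) r d v :
  uniform r H -> (forall v, degree H v <= d) ->
  #|[set p in cherries H | v \in cherry_union p]|
    <= 3 * (d * (r * d) * (r * d)).
Proof.
move=> Hr Hd; set star := [set A in H | v \in A].
have nbrs A : A \in H -> #|edge_nbrs H A| <= r * d.
  by move=> AH; rewrite -(Hr A AH) card_edge_nbrs.
have starH A : A \in star -> A \in H by rewrite inE => /andP[].
pose pairs := [set p | p.1 \in star & p.2 \in edge_nbrs H p.1].
have card_pairs : #|pairs| <= d * (r * d).
  apply: leq_trans (card_dependent_pairs
    (F := edge_nbrs H) (m := r * d) _) _.
    by move=> A /starH /nbrs.
  by rewrite leq_mul2r Hd orbT.
(* [mid] covers the cherries with [v] in the middle hyperedge; [far] serves for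
   both ends, its entries being walks end, middle, other end. *)
pose mid := [set p | p.1 \in pairs & p.2 \in edge_nbrs H p.1.1].
pose far := [set p | p.1 \in pairs & p.2 \in edge_nbrs H p.1.2].
have card_mid : #|mid| <= d * (r * d) * (r * d).
  apply: leq_trans (card_dependent_pairs
    (F := fun q : {set T} * {set T} => edge_nbrs H q.1) (m := r * d) _) _.
    by move=> p; rewrite inE => /andP[/starH /nbrs].
  by rewrite leq_mul2r card_pairs orbT.
have card_far : #|far| <= d * (r * d) * (r * d).
  apply: leq_trans (card_dependent_pairs
    (F := fun q : {set T} * {set T} => edge_nbrs H q.2) (m := r * d) _) _.
    by move=> p; rewrite inE => /andP[_]; rewrite inE => /andP[/nbrs].
  by rewrite leq_mul2r card_pairs orbT.
have sub : [set p in cherries H | v \in cherry_union p] \subset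
    mid :|: [set (p.1.2, p.1.1, p.2) | p in far]
        :|: [set (p.1.2, p.2, p.1.1) | p in far].
  apply/subsetP => -[[M L] R]; rewrite inE => /andP[].
  rewrite inE /= => /and4P[MH LM RM _].
  have [LH ML] : L \in H /\ L :&: M != set0.
    by move: LM; rewrite inE setIC => /andP[].
  have [RH MR] : R \in H /\ R :&: M != set0.
    by move: RM; rewrite inE setIC => /andP[].
  rewrite /cherry_union /= in_setU in_setU => /orP[/orP[]|] v_in.
  - by rewrite in_setU in_setU inE /= inE /= inE MH v_in LM RM.
  - rewrite in_setU in_setU; apply/orP; left; apply/orP; right.
    apply/imsetP; exists (L, M, R) => //=.
    by rewrite inE /= RM andbT inE /= inE LH v_in inE MH.
  - rewrite in_setU; apply/orP; right.
    apply/imsetP; exists (R, M, L) => //=.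
    by rewrite inE /= LM andbT inE /= inE RH v_in inE MH.
apply: leq_trans (subset_leq_card sub) _.
apply: leq_trans (leq_card_setU _ _) _.
rewrite mulSn mulSn mul1n addnA leq_add //; last first.
  exact: leq_trans (leq_imset_card _ _) card_far.
apply: leq_trans (leq_card_setU _ _) _.
by rewrite leq_add //; exact: leq_trans (leq_imset_card _ _) card_far.
Qed.

(** No vertex is in all three hyperedges, so the [3r] incidences are spread over
    vertices that carry at most two each. *)
Lemma card_cherry_union (T : finType) (H : {set {set T}}) r p :
  uniform r H -> p \in cherries H -> 3 * r <= 2 * #|cherry_union p|.
Proof.
move=> Hr; rewrite inE => /and4P[MH].
rewrite inE => /andP[LH _]; rewrite inE => /andP[RH _] /eqP disj.
case: p => -[M L] R /= in MH LH RH disj *; rewrite /cherry_union /=.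
have ML : #|M :|: L| + #|M :&: L| = r + r.
  by rewrite cardsUI (Hr _ MH) (Hr _ LH).
have MLR : #|M :&: L| + r <= #|M :|: L :|: R|.
  rewrite -(Hr _ RH) -cardsUI disj cards0 addn0.
  by rewrite subset_leq_card // setSU // (subset_trans (subsetIl _ _)) // subsetUl.
have := subset_leq_card (subsetUl (M :|: L) R).
move: ML MLR; lia.
Qed.

(** Three consecutive hyperedges of a cycle form a cherry, and it inherits the
    two colors of the cycle. *)
Lemma acyclic_coloring_cherries (T C : finType) (H : {set {set T}})
    (c : {ffun T -> C}) :
  {in H, forall A, A != set0} ->
  {in H, forall A, ~~ few_colors 1 A c} ->
  {in cherries H, forall p, ~~ few_colors 2 (cherry_union p) c} ->
  acyclic_coloring H c.
Proof.
move=> H0 edges paths; split=> [A AH mono|m F m3 /subsetP FH [E [_ FE meet disj]]].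
  have /set0Pn[x xA] := H0 A AH; apply/negP: (edges A AH); rewrite negbK.
  apply/existsP; exists [tuple c x]; apply/forall_inP => y yA.
  by rewrite inE (mono y x).
move=> /eqP /cards2P[a [b [_ ab]]].
have EF i : E i \in F by rewrite FE imset_f.
pose i := Ordinal (ltn_trans (ltn_trans (ltnSn 0) (ltnSn 1)) m3).
pose p := (E i, E (ord_pred i), E (ordS i)).
have pH : p \in cherries H.
  rewrite !inE /= !FH //=; apply/and3P; split; apply/eqP.
  - by have := meet (ord_pred i); rewrite ord_predK setIC.
  - exact: meet.
  - by rewrite [E i :&: _]setIC disj.
apply/negP: (paths p pH); rewrite negbK.
apply/existsP; exists [tuple a; b]; apply/forall_inP => x xp.
have : c x \in c @: cover F.
  apply: imset_f; apply/bigcupP.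
  move: xp; rewrite !inE => /orP[/orP[]|] x_in.
  - by exists (E i).
  - by exists (E (ord_pred i)).
  - by exists (E (ordS i)).
by rewrite ab !inE.
Qed.

Local Open Scope ring_scope.

(** The local lemma for the hyperedges, with [j = 1], and the cherries, with
    [j = 2].  The union of a cherry may have more than [t] vertices, but for
    [4 <= k] the weight decreases with the size of the union. *)
Lemma acyclic_colorable_weight (R : realFieldType) (T : finType)
    (H : {set {set T}}) (r d k t : nat) :
  (0 < r)%N -> uniform r H -> (forall v, (degree H v <= d)%N) ->
  (4 <= k)%N -> (2 * t <= (3 * r).+1)%N ->
  d%:R * (k%:R * (2 / k%:R) ^+ r) <= 1 / 2 :> R ->
  (3 * (d * (r * d) * (r * d)))%:R * (k%:R ^+ 2 * (4 / k%:R) ^+ t) <= 1 / 2 :> R ->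
  acyclic_colorable H k.
Proof.
move=> r_gt0 Hr Hd k4 tr w1 w2.
have k_gt0 : 0 < k%:R :> R by rewrite ltr0n (leq_trans _ k4).
pose Phi := [seq (1%N, A) | A <- enum H]
  ++ [seq (2%N, cherry_union p) | p <- enum (cherries H)].
have H0 : {in H, forall A, A != set0}.
  by move=> A AH; rewrite -card_gt0 (Hr A AH).
have [||v|c cP] := @few_colors_local_lemma R T 'I_k Phi; last first.
- exists c; apply: acyclic_coloring_cherries => // [A AH|p pH].
    by apply: (cP (1%N, A)); rewrite mem_cat map_f ?mem_enum.
  by apply: (cP (2%N, cherry_union p)); rewrite mem_cat orbC map_f ?mem_enum.
- rewrite card_ord big_cat /= !big_map !big_enum_cond /=.
  rewrite [leRHS](_ : 1 = 1 / 2 + 1 / 2); last by field.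
  apply: lerD; [apply: le_trans w1|apply: le_trans w2].
    apply: (@le_trans _ _ (\sum_(A in [set A in H | v \in A])
        k%:R * (2 / k%:R) ^+ r)).
      rewrite [leRHS](eq_bigl (fun A => (A \in H) && (v \in A))) => [|A];
        last by rewrite inE.
      apply: ler_sum => A /andP[AH _].
      by rewrite /weight /= (Hr A AH).
    rewrite sumr_const -[leLHS]mulr_natl ler_wpM2r //.
      by rewrite mulr_ge0 ?exprn_ge0 ?divr_ge0 // ltW.
    by rewrite ler_nat; apply: Hd.
  apply: (@le_trans _ _ (\sum_(p in [set p in cherries H | v \in cherry_union p])
      k%:R ^+ 2 * (4 / k%:R) ^+ t)).
    rewrite [leRHS](eq_bigl
      (fun p => (p \in cherries H) && (v \in cherry_union p))) => [|p];
      last by rewrite in_set.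
    apply: ler_sum => p /andP[pH _].
    rewrite /weight /= ler_wpM2l ?exprn_ge0 ?(ltW k_gt0) //.
    apply: ler_wiXn2l.
    - by rewrite divr_ge0 // ltW.
    - by rewrite ler_pdivrMr // mul1r ler_nat.
    - have := card_cherry_union Hr pH; lia.
  rewrite sumr_const -[leLHS]mulr_natl ler_wpM2r //.
    by rewrite mulr_ge0 ?exprn_ge0 ?divr_ge0 // ltW.
  by rewrite ler_nat; apply: card_cherries.
- move=> f; rewrite mem_cat => /orP[] /mapP[A]; rewrite mem_enum => AH -> /=.
    exact: H0.
  rewrite -card_gt0; have := card_cherry_union Hr AH; lia.
- by rewrite card_ord (leq_trans _ k4).
Qed.

(** * The maximum over all hypergraphs *)

(** The [d] hyperedges share a core of [r - 1] vertices and have one private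
    vertex each; a core vertex exists as [1 < r], and its degree is [d]. *)
Lemma exists_uniform_max_degree (r d : nat) : (1 < r)%N ->
  exists (n : nat) (H : {set {set 'I_n}}), uniform r H /\ max_degree H = d.
Proof.
case: r => // q; rewrite ltnS => q_gt0.
pose core := [set lshift d i | i : 'I_q].
pose petal (j : 'I_d) := rshift q j |: core.
have rshift_core j : rshift q j \notin core.
  by apply/imsetP => -[i _] /eqP; rewrite eq_rlshift.
have petal_inj : injective petal.
  move=> j j' jj'; have : rshift q j \in petal j' by rewrite -jj' setU11.
  by rewrite in_setU1 (negPf (rshift_core j)) orbF => /eqP /rshift_inj.
exists (q + d)%N, [set petal j | j : 'I_d]; split.
  move=> A /imsetP[j _ ->].
  by rewrite cardsU1 rshift_core card_imset ?card_ord //; exact: lshift_inj.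
have cardH : #|[set petal j | j : 'I_d]| = d by rewrite card_imset ?card_ord.
apply/eqP; rewrite eqn_leq; apply/andP; split.
  apply/bigmax_leqP => v _; rewrite -[leqRHS]cardH.
  by apply: subset_leq_card; apply/subsetP => A; rewrite inE => /andP[].
pose v := lshift d (Ordinal q_gt0).
apply: leq_trans (leq_bigmax v); rewrite -[leqLHS]cardH.
apply: subset_leq_card; apply/subsetP => A AH; rewrite inE AH /=.
by case/imsetP: AH => j _ ->; rewrite in_setU1 imset_f ?orbT.
Qed.

(** A common bound on the chromatic numbers makes the maximum exist, although
    infinitely many hypergraphs compete. *)
Lemma exists_max_acyclic_chromatic_number (r d k : nat) : (3 <= r)%N ->
  (forall n (H : {set {set 'I_n}}), uniform r H -> max_degree H = d ->
     acyclic_colorable H k) ->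
  exists2 m, is_max_acyclic_chromatic_number r d m & (m <= k)%N.
Proof.
move=> r3 colorable.
pose attained m := `[< exists n (H : {set {set 'I_n}}),
  [/\ uniform r H, max_degree H = d & acyclic_chromatic_number H = m] >].
have attained_ex : exists m, attained m.
  have [n [H [uH dH]]] := exists_uniform_max_degree d (ltnW r3).
  by exists (acyclic_chromatic_number H); apply/asboolP; exists n, H.
have attained_le m : attained m -> (m <= k)%N.
  move=> /asboolP[n [H [uH dH <-]]].
  by apply: (acyclic_chromatic_numberP r3 uH).2; apply: colorable.
exists (ex_maxn attained_ex attained_le); case: ex_maxnP => m m_att m_max; last first.
  exact: attained_le.
split; first exact/asboolP.
by move=> n H uH dH; apply: m_max; apply/asboolP; exists n, H.
Qed.

(** * The number of colors *)

Lemma expr_le_powR (R : realType) (a e : R) (m n : nat) :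
  1 <= a -> m%:R <= e * n%:R -> a ^+ m <= (a `^ e) ^+ n.
Proof.
move=> a1 me; have a0 : 0 <= a by apply: le_trans a1.
by rewrite -!powR_mulrn ?powR_ge0 // -powRrM ler_powR.
Qed.

(** With [X = a^(6/(3r-4))] and [a = rd], the ratio [b/k] is at most [b/(16 X)].
    For hyperedges [X^(r-1) >= a], and for cherries [X^(t-2) >= a^3], where [t]
    is [3r/2] rounded up: the exponent is chosen for the latter.  The powers of
    [16/b] absorb all constants. *)
Lemma acyclic_colorable_powR (R : realType) (T : finType) (H : {set {set T}})
    (r d k : nat) :
  (3 <= r)%N -> (1 <= d)%N -> uniform r H -> (forall v, (degree H v <= d)%N) ->
  16 * (r%:R * d%:R) `^ (6 / (3 * r%:R - 4)) <= k%:R :> R ->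
  acyclic_colorable H k.
Proof.
move=> r3 d1 Hr Hd; set a : R := r%:R * d%:R; set e : R := 6 / _.
set X := a `^ e => Xk.
have r3R : 3 <= r%:R :> R by rewrite ler_nat.
have d1R : 1 <= d%:R :> R by rewrite ler1n.
have a3 : 3 * d%:R <= a by rewrite /a ler_wpM2r // ler0n.
have a1 : 1 <= a by lra.
have e0 : 0 < 3 * r%:R - 4 :> R by lra.
have X1 : 1 <= X.
  by rewrite -[leLHS](powRr0 a) ler_powR // divr_ge0 // ltW.
have k0 : 0 < k%:R :> R by lra.
have scaled_expr (b : R) n : 0 < b -> (b / k%:R) ^+ n * (16 / b * X) ^+ n <= 1.
  move=> b0; rewrite -exprMn.
  have -> : b / k%:R * (16 / b * X) = 16 * X / k%:R.
    by field; rewrite !gt_eqF.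
  by rewrite exprn_ile1 // ?ler_pdivrMr ?mul1r // divr_ge0 ?ler0n // mulr_ge0 ?powR_ge0.
apply: (@acyclic_colorable_weight R _ H r d k (uphalf (3 * r))) => //.
- exact: leq_trans r3.
- by rewrite -(ler_nat R); lra.
- lia.
- have [s rE s2] : exists2 s, r = s.+1 & (2 <= s)%N by exists r.-1; lia.
  have rER : r%:R = s%:R + 1 :> R by rewrite rE -natr1.
  pose Y := (2 / k%:R : R) ^+ s.
  have -> : k%:R * (2 / k%:R) ^+ r = 2 * Y.
    by rewrite rE exprS mulrA -/Y; congr (_ * _); field; rewrite gt_eqF.
  have Y0 : 0 <= Y by rewrite exprn_ge0 // divr_ge0 // ltW.
  have Xs : a <= X ^+ s.
    rewrite -[leLHS]expr1 expr_le_powR // /e mulrAC ler_pdivlMr //; lra.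
  (* [8^2] is large enough, so the exponent [s] can be lowered to its least
     possible value; the same is done for [4^u] below. *)
  have s8 : (16 / 2 : R) ^+ 2 <= (16 / 2) ^+ s by rewrite ler_weXn2l //; lra.
  have : Y * ((16 / 2) ^+ 2 * a) <= 1.
    apply: le_trans (scaled_expr 2 s _); last by lra.
    by rewrite -/Y [(_ * X) ^+ _]exprMn ler_wpM2l // ler_pM // ?exprn_ge0 //; lra.
  have : Y * (3 * d%:R) <= Y * a by rewrite ler_wpM2l.
  lra.
(* [u] is [t - 2], the exponent left once the factor [k^2] for the choice of
   the two colors has been used up. *)
- have [u tE [u3 ur]] : exists2 u, uphalf (3 * r) = u.+2 &
      (3 <= u)%N /\ (3 * r <= 2 * u + 4)%N.
    by exists (uphalf (3 * r)).-2; lia.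
  have urR : 3 * r%:R <= 2 * u%:R + 4 :> R.
    by rewrite -!natrM -natrD ler_nat.
  pose Z := (4 / k%:R : R) ^+ u.
  have -> : k%:R ^+ 2 * (4 / k%:R) ^+ uphalf (3 * r) = 16 * Z.
    by rewrite tE !exprS expr0 -/Z; field; rewrite gt_eqF.
  have Z0 : 0 <= Z by rewrite exprn_ge0 // divr_ge0 // ltW.
  have Xu : a ^+ 3 <= X ^+ u.
    rewrite expr_le_powR // /e mulrAC ler_pdivlMr //; lra.
  have u4 : (16 / 4 : R) ^+ 3 <= (16 / 4) ^+ u by rewrite ler_weXn2l //; lra.
  have : Z * ((16 / 4) ^+ 3 * a ^+ 3) <= 1.
    apply: le_trans (scaled_expr 4 u _); last by lra.
    rewrite -/Z [(_ * X) ^+ _]exprMn ler_wpM2l // ler_pM // ?exprn_ge0 //; lra.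
  have : Z * (3 * (d * (r * d) * (r * d)))%:R <= Z * a ^+ 3.
    rewrite ler_wpM2l // !natrM -/a !exprS expr0 mulr1 !mulrA.
    by rewrite !ler_wpM2r //; lra.
  lra.
Qed.

Theorem corollary4 (R : realType) (r d : nat) (hr : (3 <= r)%N) (hd : (1 <= d)%N) :
  exists m : nat,
    is_max_acyclic_chromatic_number r d m /\
    (m%:R : R) <=
      (2 : R) `^ (9 * r%:R / 2 - 2) * 3 ^+ 3 * (r%:R * d%:R) `^ (6 / (3 * r%:R - 4)).
Proof.
set X : R := _ `^ (6 / _); have r3R : 3 <= r%:R :> R by rewrite ler_nat.
have d1R : 1 <= d%:R :> R by rewrite ler1n.
have X1 : 1 <= X.
  rewrite -[leLHS](powRr0 (r%:R * d%:R)) ler_powR ?divr_ge0 //; last by lra.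
  by rewrite -[leLHS]mulr1 ler_pM //; lra.
pose k := (Num.trunc (16 * X)).+1.
have /truncn_itv /andP[kX Xk] : 0 <= 16 * X by lra.
(* Rounding up keeps [k] at most [16 X + 1], hence at most [32 X]. *)
have kS : k%:R = (Num.trunc (16 * X))%:R + 1 :> R by rewrite natr1.
have [|m m_max mk] := @exists_max_acyclic_chromatic_number r d k hr.
  move=> n H uH dH; apply: acyclic_colorable_powR hr hd uH _ (ltW Xk) => v.
  by rewrite -dH; exact: (leq_bigmax v).
exists m; split => //; apply: (@le_trans _ _ k%:R); first by rewrite ler_nat.
have pow2 : 32 <= (2 : R) `^ (9 * r%:R / 2 - 2).
  have -> : 32 = (2 : R) `^ 5%:R by rewrite powR_mulrn // -natrX.
  by rewrite ler_powR ?ler1n //; lra.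
apply: (@le_trans _ _ (32 * X)); first by lra.
rewrite ler_wpM2r ?powR_ge0 //; lra.
Qed.
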